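(* Let $q$ be a prime power and let $k$ be an integer with $0\le k\le q+1$. Let $W$ be a $\mathrm{GL}_2(\mathbb F_q)$-invariant subspace of $\mathbb F_q[X,Y]_k$. If $\mathcal B_W\neq\varnothing$, then $(\mathbb P^1(\mathbb F_q),\mathcal B_W)$ is a $3$-$(q+1,k,\lambda)$ design for some $\lambda$.
   Context: $\mathbb F_q[X,Y]_k$ is the $\mathbb F_q$-space of homogeneous polynomials of degree $k$ in $X,Y$ over $\mathbb F_q$ (including $0$). The group $\mathrm{GL}_2(\mathbb F_q)$ acts on it by $(g\cdot f)(X,Y)=f(dX-bY,-cX+aY)$ for $g=\begin{pmatrix}a&b\\c&d\end{pmatrix}$; an $\mathbb F_q$-subspace $W$ is $\mathrm{GL}_2(\mathbb F_q)$-invariant if $g\cdot f\in W$ for all $g\in\mathrm{GL}_2(\mathbb F_q)$, $f\in W$. $\mathbb P^1(\mathbb F_q)=\mathbb F_q\cup\{\infty\}$, where $x\in\mathbb F_q$ corresponds to $[x:1]$ and $\infty$ to $[1:0]$. For a $k$-subset $S\subseteq\mathbb P^1(\mathbb F_q)$, $F_S(X,Y)=\prod_{t\in S}(X-tY)\in\mathbb F_q[X,Y]_k$, where the factor for $t=\infty$ is taken to be $Y$. The block set is $\mathcal B_W=\{S\subseteq\mathbb P^1(\mathbb F_q): |S|=k,\ F_S\in W\}$. A $t$-$(v,k,\lambda)$ design is a pair $(P,\mathcal B)$ with $P$ a finite set, $|P|=v$, and $\mathcal B$ a set of $k$-subsets of $P$ (blocks) such that every $t$-subset of $P$ is contained in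 exactly $\lambda$ blocks. *)

(* Defs.v *)
From mathcomp Require Import all_boot all_order all_algebra.
From mathcomp Require Import mpoly.

Set Implicit Arguments.
Unset Strict Implicit.
Unset Printing Implicit Defensive.

Import GRing.Theory.
Local Open Scope ring_scope.

Section BinaryForms.
Variable F : finFieldType.

(* 'X_0 plays the role of X and 'X_1 that of Y. *)
Definition varX : {mpoly F[2]} := 'X_(0 : 'I_2).
Definition varY : {mpoly F[2]} := 'X_(1 : 'I_2).

(* F[X,Y]_k, including 0: a vectType over F. *)
Definition binary_form (k : nat) := dhomog 2 F k.

(* (g . f)(X, Y) = f(d X - b Y, - c X + a Y) for g = (a b; c d). *)
Definition gl2_subst (g : {'GL_2[F]}) (f : {mpoly F[2]}) : {mpoly F[2]} :=
  f \mPo [tuple g 1 1 *: varX - g 0 1 *: varY;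
                - g 1 0 *: varX + g 0 0 *: varY].

Lemma gl2_subst_homog k (g : {'GL_2[F]}) (f : {mpoly F[2]}) :
  f \is k.-homog -> gl2_subst g f \is k.-homog.
Proof.
move=> /dhomogP hf; rewrite /gl2_subst comp_mpolyE big_seq.
apply: rpred_sum => m /hf dm; apply: dhomogZ.
have hX i : 'X_i \is [in F[2], 1.-homog] by rewrite dhomogX /= mdeg1.
have hM e (p : {mpoly F[2]}) : p \is [in F[2], 1.-homog] -> p ^+ e \is [in F[2], e.-homog].
  by move=> hp; rewrite -[X in _ \is X.-homog]mul1n; apply: dhomogMn.
rewrite -dm /= mdegE !big_ord_recl !big_ord0 mulr1 addn0.
by apply: dhomogM; apply: hM; rewrite !(tnth_nth 0) /= -?scaleNr;
   apply: rpredD; apply: dhomogZ; exact: hX.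
Qed.

Definition gl2_act k (g : {'GL_2[F]}) (f : binary_form k) : binary_form k :=
  DHomog (gl2_subst_homog g (dhomog_is_dhomog f)).

Definition gl2_invariant k (W : {vspace binary_form k}) : Prop :=
  forall (g : {'GL_2[F]}) (f : binary_form k), f \in W -> gl2_act g f \in W.

(* P^1(F) = F U {oo}: Some x is [x : 1] and None is oo = [1 : 0]. *)
Definition P1 := option F.

Definition point_form (t : P1) : {mpoly F[2]} :=
  if t is Some x then varX - x *: varY else varY.

Definition set_form (S : {set P1}) : {mpoly F[2]} := \prod_(t in S) point_form t.

Lemma set_form_homog (S : {set P1}) : set_form S \is #|S|.-homog.
Proof.
have hX i : 'X_i \is [in F[2], 1.-homog] by rewrite dhomogX /= mdeg1.
rewrite /set_form -sum1_card.
elim/big_rec2: _ => [|t d p _ hp]; first exact: dhomog1.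
apply: dhomogM => //; case: t => [x|] /=; last exact: hX.
by rewrite -scaleNr; apply: rpredD; [|apply: dhomogZ]; exact: hX.
Qed.

(* ['dhomog_k p] coerces p into binary_form k, with the default value 0 when p
   is not k-homogeneous; by set_form_homog the default is never used here. *)
Definition blocks k (W : {vspace binary_form k}) : {set {set P1}} :=
  [set S : {set P1} | (#|S| == k) && (['dhomog_k (set_form S)] \in W)].

Lemma in_blocks k (W : {vspace binary_form k}) (S : {set P1}) :
  reflect (#|S| = k /\ exists2 f, f \in W & mpoly_of_dhomog f = set_form S)
          (S \in blocks W).
Proof.
rewrite inE; apply: (iffP andP) => [[/eqP Sk WS]|[Sk [f Wf fS]]].
  split=> //; exists ['dhomog_k (set_form S)] => //.
  by rewrite [LHS]insubdK // -Sk; exact: set_form_homog.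
split; first exact/eqP.
suff -> : ['dhomog_k (set_form S)] = f by [].
by rewrite -fS; exact: (valKd 0 f).
Qed.

End BinaryForms.

(* t-(v,k,lambda) design whose point set is the whole finite type T. *)
Definition is_design (T : finType) (t v k lambda : nat) (B : {set {set T}}) :
    Prop :=
  [/\ #|T| = v,
      forall b : {set T}, b \in B -> #|b| = k &
      forall A : {set T}, #|A| = t -> #|[set b in B | A \subset b]| = lambda].

(* Main.v *)
(** The blocks containing a 3-subset [A] are counted by a function of [A] that
    is invariant under every permutation of the projective line preserving the
    block set.  The homographies [x |-> x + b], [x |-> a x] and [x |-> 1 / x]
    are such permutations, because the matrices inducing them send each linear
    form [point_form t] to a nonzero multiple of the form of the image point.
    Composites of these three maps carry any 3-subset to [{oo, 0, 1}]. *)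
Require Import Defs.
From mathcomp Require Import all_boot all_order all_algebra.
From mathcomp Require Import mpoly.

Set Implicit Arguments.
Unset Strict Implicit.
Unset Printing Implicit Defensive.

Import GRing.Theory.
Local Open Scope ring_scope.

(** By finiteness, an injection sending [B] into itself sends it onto itself, so no point outside
    [B] can land in [B]. *)
Lemma inj_endo_mem (T : finType) (f : T -> T) (B : {set T}) :
  injective f -> {homo f : x / x \in B} -> forall x, (f x \in B) = (x \in B).
Proof.
move=> finj fB x; have /eqP {1}<- : f @: B == B.
  rewrite eqEcard card_imset // leqnn andbT.
  by apply/subsetP=> _ /imsetP[y yB ->]; exact: fB.
by rewrite mem_imset.
Qed.

Lemma cards3P (T : finType) (A : {set T}) :
  #|A| = 3%N -> exists u v w, [/\ u != v, u != w, v != w & A = [set u; v; w]].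
Proof.
move=> cA; have /card_gt0P[u uA] : (0 < #|A|)%N by rewrite cA.
have /eqP/cards2P[v [w [vw Dvw]]] : #|A :\ u| = 2%N.
  by have := cardsD1 u A; rewrite uA cA => -[].
exists u, v, w; move/setP: (Dvw) => D.
have := D v; have := D w; rewrite !inE !eqxx orbT /=.
case/andP=> wu _ /andP[vu _]; split=> //; rewrite 1?eq_sym //.
by rewrite -(setD1K uA) Dvw setUA.
Qed.

Section Automorphisms.
Variables (T : finType) (B : {set {set T}}).

(** One direction is enough: [T] is finite, so the converse follows by [inj_endo_mem] applied to the
    image map on sets. *)
Definition automorphism (f : T -> T) :=
  injective f /\ {homo (fun S : {set T} => f @: S) : S / S \in B}.

Lemma automorphism_comp f g :
  automorphism f -> automorphism g -> automorphism (f \o g).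
Proof.
move=> [fi fB] [gi gB]; split; first exact: inj_comp.
by move=> S SB; rewrite imset_comp; apply/fB/gB.
Qed.

(** Taking images under [f] is a bijection from the blocks containing [A] to those containing
    [f @: A]. *)
Lemma card_blocks_automorphism f (A : {set T}) : automorphism f ->
  #|[set b in B | f @: A \subset b]| = #|[set b in B | A \subset b]|.
Proof.
move=> [fi fB]; have Fi := imset_inj fi.
have [f' fK f'K] := injF_bij fi.
rewrite -[RHS](card_imset _ Fi); apply: eq_card => b.
(* Since [f] is bijective, every candidate block is an image under [f], so membership can be tested
   on its preimage. *)
have -> : b = f @: (f' @: b) by rewrite -imset_comp (eq_imset _ f'K) imset_id.
rewrite (mem_imset _ _ Fi) !inE (inj_endo_mem Fi fB); congr (_ && _).
apply/idP/idP=> [/subsetP h|]; last exact: imsetS.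
by apply/subsetP=> x /(imset_f f)/h; rewrite mem_imset.
Qed.

End Automorphisms.

Section Homographies.
Variable F : finFieldType.

Lemma gl2_of_entries (a b c d : F) : a * d - b * c != 0 ->
  exists g : {'GL_2[F]}, [/\ g 0 0 = a, g 0 1 = b, g 1 0 = c & g 1 1 = d].
Proof.
move=> nz; pose M : 'M[F]_2 := \matrix_(i, j)
  (if i == 0 then if j == 0 then a else b else if j == 0 then c else d).
have Mu : M \is a GRing.unit.
  rewrite -[_ \is a _]/(M \in unitmx) unitmxE unitfE (expand_det_row _ 0).
  rewrite !big_ord_recl big_ord0 /cofactor !det_mx11 !mxE /= addr0.
  by rewrite expr0 mul1r expr1 mulN1r mulrN.
by exists (FinRing.unit _ Mu); split; rewrite /GLval /= !mxE.
Qed.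

Lemma gl2_subst_point_form (g : {'GL_2[F]}) (t : P1 F) :
  gl2_subst g (point_form t) =
    if t is Some x
    then (g 1 1 + x * g 1 0) *: varX F - (g 0 1 + x * g 0 0) *: varY F
    else - g 1 0 *: varX F + g 0 0 *: varY F.
Proof.
rewrite /gl2_subst /point_form; case: t => [x|]; last by rewrite comp_mpolyXU.
rewrite rmorphB /= comp_mpolyZ !comp_mpolyXU /=.
rewrite scalerDr !scalerA !scalerDl opprD mulrN scaleNr opprD opprK.
by rewrite !addrA; congr (_ - _); rewrite addrAC.
Qed.

Section Blocks.
Variables (k : nat) (W : {vspace binary_form F k}).
Hypothesis hW : gl2_invariant W.

(** Substitution is multiplicative, so [g] turns the form of [S] into that of [f @: S] times the
    product of the [c t]. This scalar is nonzero and can be divided out inside the subspace [W]. *)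
Lemma gl2_automorphism (g : {'GL_2[F]}) (f : P1 F -> P1 F) (c : P1 F -> F) :
    injective f -> (forall t, c t != 0) ->
    (forall t, gl2_subst g (point_form t) = c t *: point_form (f t)) ->
  automorphism (blocks W) f.
Proof.
move=> fi cn fE; split=> // S /in_blocks[Sk [p Wp pS]].
apply/in_blocks; split; first by rewrite card_imset.
pose C := \prod_(t in S) c t.
have Cn : C != 0 by apply/prodf_neq0.
exists (C^-1 *: gl2_act g p); first by apply/memvZ/hW.
rewrite linearZ /= pS /set_form /gl2_subst rmorph_prod /=.
rewrite (eq_bigr (fun t => c t *: point_form (f t)));
  last by move=> t _; exact: fE.
rewrite scaler_prod scalerA mulVf // scale1r big_imset //.
by move=> ? ? _ _ /fi.
Qed.

Definition affine (a b : F) (t : P1 F) : P1 F := omap (fun x => a * x + b) t.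

Definition inversion (t : P1 F) : P1 F :=
  if t is Some x then if x == 0 then None else Some x^-1 else Some 0.

Lemma affine_automorphism a b : a != 0 -> automorphism (blocks W) (affine a b).
Proof.
move=> an.
have [|g [g00 g01 g10 g11]] := @gl2_of_entries a b 0 1.
  by rewrite mulr1 mulr0 subr0.
(* Here X becomes X - bY and Y becomes aY, so only the form at infinity is rescaled. *)
apply: (@gl2_automorphism g _ (fun t => if t is Some _ then 1 else a)).
- by move=> [x|] [y|] //= [/addIr/(mulfI an)->].
- by case=> [x|] //; exact: oner_neq0.
case=> [x|]; rewrite gl2_subst_point_form g00 ?g01 g10 ?g11 /=.
  by rewrite mulr0 addr0 !scale1r (mulrC x) (addrC b).
by rewrite oppr0 scale0r add0r.
Qed.

Lemma inversion_automorphism : automorphism (blocks W) inversion.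
Proof.
have [|g [g00 g01 g10 g11]] := @gl2_of_entries 0 1 1 0.
  by rewrite mulr1 mulr0 sub0r oppr_eq0 oner_neq0.
(* Here X becomes -Y and Y becomes -X, so X - xY becomes xX - Y: this is x(X - Y/x) for nonzero x,
   and -Y for x = 0. *)
apply: (@gl2_automorphism g _
  (fun t => if t is Some x then if x == 0 then -1 else x else -1)).
(* [inversion] is an involution. *)
- apply: (can_inj (g := inversion)) => -[x|] /=; last by rewrite eqxx.
  by case: eqVneq => [->|xn] //=; rewrite invr_eq0 (negPf xn) invrK.
- case=> [x|]; last by rewrite oppr_eq0 oner_neq0.
  by case: (eqVneq x 0) => // _; rewrite oppr_eq0 oner_neq0.
case=> [x|]; rewrite gl2_subst_point_form g00 ?g01 g10 ?g11 /=.
  rewrite mulr1 mulr0 add0r addr0 scale1r.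
  case: (eqVneq x 0) => [->|xn] /=; first by rewrite scale0r sub0r scaleN1r.
  by rewrite scalerBr scalerA mulfV // scale1r.
by rewrite !scale0r subr0 addr0.
Qed.

Lemma automorphism_3_transitive (u v w : P1 F) : u != v -> u != w -> v != w ->
  exists2 f, automorphism (blocks W) f &
    [/\ f u = None, f v = Some 0 & f w = Some 1].
Proof.
have infty (v' w' : P1 F) : None != v' -> None != w' -> v' != w' ->
    exists2 f, automorphism (blocks W) f &
      [/\ f None = None, f v' = Some 0 & f w' = Some 1].
  case: v' w' => [x|] [y|] // _ _ xy.
  have yx : y - x != 0 by rewrite subr_eq0; apply: contraNneq xy => ->.
  (* This is the map z -> (z - x) / (y - x), which fixes infinity. *)
  exists (affine (y - x)^-1 (- ((y - x)^-1 * x))).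
    by apply: affine_automorphism; rewrite invr_eq0.
  by split=> //=; rewrite -mulrBr ?subrr ?mulr0 ?mulVf.
case: u => [x|] uv uw vw; last exact: infty.
(* The map z -> 1 / (z - x) moves the finite point [u] to infinity, which reduces to the case
   already treated. *)
pose h := inversion \o affine 1 (- x).
have [hi hB] : automorphism (blocks W) h.
  apply: automorphism_comp inversion_automorphism _.
  exact/affine_automorphism/oner_neq0.
have hx : h (Some x) = None by rewrite /h /= mul1r subrr eqxx.
(* Writing infinity as [h (Some x)] makes all three distinctness conditions follow from injectivity
   of [h]. *)
have [||| f fA [f0 f1 f2]] := infty (h v) (h w); rewrite -?hx ?(inj_eq hi) //.
exists (f \o h); first exact: automorphism_comp fA (conj hi hB).
by split=> //=; rewrite hx.
Qed.

End Blocks.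
End Homographies.

Local Close Scope ring_scope.

Theorem proposition2 (q : nat) (F : finFieldType) (hq : #|F| = q)
    (k : nat) (hk : k <= q + 1) (W : {vspace (binary_form F k)})
    (hW : gl2_invariant W) (hB : blocks W <> set0) :
  exists lambda : nat, @is_design (P1 F) 3 (q + 1) k lambda (blocks W).
Proof.
pose A0 : {set P1 F} := [set None; Some 0%R; Some 1%R].
exists #|[set b in blocks W | A0 \subset b]|; split.
- by rewrite card_option hq addn1.
- by move=> b /in_blocks[].
move=> A /cards3P[u [v [w [uv uw vw ->]]]].
have [f fA [fu fv fw]] := automorphism_3_transitive hW uv uw vw.
rewrite -(card_blocks_automorphism _ fA); congr #|pred_of_set _|.
by rewrite !imsetU !imset_set1 fu fv fw.
Qed.
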